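(* Let $\boldsymbol v\in\Upsilon$ be a vertex of $\Gamma$ that is not a sink, and let $\boldsymbol\Phi_{\boldsymbol v}$ be a real $k_{\boldsymbol v}\times 2|J_{\boldsymbol v}|$ matrix. The boundary system at $\boldsymbol v$ $$\boldsymbol\Phi_{\boldsymbol v}\,\mathcal F(\boldsymbol v)\,\boldsymbol u(\boldsymbol v)=0$$ is equivalent to $$\boldsymbol\Phi_{\boldsymbol v}\,\mathcal F_{out}(\boldsymbol v)\,\boldsymbol u_{out}(\boldsymbol v)+\boldsymbol\Phi_{\boldsymbol v}\,\mathcal F_{in}(\boldsymbol v)\,\boldsymbol u_{in}(\boldsymbol v)=0,$$ and hence it uniquely determines the outgoing values $\boldsymbol u_{out}(\boldsymbol v)$ at $\boldsymbol v$ (that is, for every $\boldsymbol u_{in}(\boldsymbol v)\in\mathbb R^{2|J_{\boldsymbol v}|-k_{\boldsymbol v}}$ there is exactly one $\boldsymbol u_{out}(\boldsymbol v)\in\mathbb R^{k_{\boldsymbol v}}$ for which the system holds) if and only if the $k_{\boldsymbol v}\times k_{\boldsymbol v}$ matrix $\boldsymbol\Phi_{\boldsymbol v}\mathcal F_{out}(\boldsymbol v)$ is nonsingular. In that case $$\boldsymbol u_{out}(\boldsymbol v)=-\bigl(\boldsymbol\Phi_{\boldsymbol v}\mathcal F_{out}(\boldsymbol v)\bigr)^{-1}\boldsymbol\Phi_{\boldsymbol v}\mathcal F_{in}(\boldsymbol v)\,\boldsymbol u_{in}(\boldsymbol v).$$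
   Context: $\Gamma$ is a finite, connected, simple metric graph with vertex set $\Upsilon$ and edges $\boldsymbol e_1,\dots,\boldsymbol e_m$. Each edge $\boldsymbol e_j$ is identified with $[0,1]$ through an invertible map $l_j:\boldsymbol e_j\to[0,1]$, so for each endpoint $\boldsymbol v$ of $\boldsymbol e_j$ one has $l_j(\boldsymbol v)\in\{0,1\}$. For a vertex $\boldsymbol v$, $J_{\boldsymbol v}=\{j:\ \boldsymbol e_j \text{ is incident to } \boldsymbol v\}$. On each edge a real $2\times2$ matrix function $\mathcal M^j(x)$, $x\in[0,1]$, is given, having for every $x$ two distinct real nonzero eigenvalues $\lambda^j_-(x)<\lambda^j_+(x)$, with corresponding eigenvectors $f^j_\pm=(f^j_{\pm,1},f^j_{\pm,2})^T$. The number $\alpha_j\in\{0,1,2\}$ of positive eigenvalues on $\boldsymbol e_j$ does not depend on $x$. Put $$\mathcal F^j=\begin{pmatrix} f^j_{+,1}&f^j_{-,1}\\ f^j_{+,2}&f^j_{-,2}\end{pmatrix},\qquad \mathcal F(\boldsymbol v)=\mathrm{diag}\{\mathcal F^j(l_j(\boldsymbol v))\}_{j\in J_{\boldsymbol v}}$$ (block diagonal, of size $2|J_{\boldsymbol v}|\times 2|J_{\boldsymbol v}|$). The vector $\boldsymbol u(\boldsymbol v)=\bigl((u^j_1(\boldsymbol v),u^j_2(\boldsymbol v))\bigr)_{j\in J_{\boldsymbol v}}\in\mathbb R^{2|J_{\boldsymbol v}|}$ collects the endpoint values at $\boldsymbol v$ of the Riemann invariants $u^j_1$ (associated with $\lambda^j_+$)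 and $u^j_2$ (associated with $\lambda^j_-$). Outgoing values at $\boldsymbol v$, for $j\in J_{\boldsymbol v}$: - if $l_j(\boldsymbol v)=0$: both $u^j_1(\boldsymbol v),u^j_2(\boldsymbol v)$ when $\alpha_j=2$; only $u^j_1(\boldsymbol v)$ when $\alpha_j=1$; none when $\alpha_j=0$; - if $l_j(\boldsymbol v)=1$: none when $\alpha_j=2$; only $u^j_2(\boldsymbol v)$ when $\alpha_j=1$; both $u^j_1(\boldsymbol v),u^j_2(\boldsymbol v)$ when $\alpha_j=0$. All other entries of $\boldsymbol u(\boldsymbol v)$ are incoming. The number of outgoing values at $\boldsymbol v$ is $k_{\boldsymbol v}=\sum_{j\in J_{\boldsymbol v}}\bigl(2(1-\alpha_j)l_j(\boldsymbol v)+\alpha_j\bigr)$. The vertex $\boldsymbol v$ is a sink if for every $j\in J_{\boldsymbol v}$ either $\alpha_j=2$ and $l_j(\boldsymbol v)=1$, or $\alpha_j=0$ and $l_j(\boldsymbol v)=0$ (equivalently, $k_{\boldsymbol v}=0$). The matrix $\widetilde{\mathcal F}_{out}(\boldsymbol v)=\mathrm{diag}\{\widetilde{\mathcal F}^j_{out}(\boldsymbol v)\}_{j\in J_{\boldsymbol v}}$ is block diagonal, where $\widetilde{\mathcal F}^j_{out}(\boldsymbol v)$ is obtained from $\mathcal F^j(l_j(\boldsymbol v))$ by replacing with zero each column whose corresponding value ($u^j_1(\boldsymbol v)$ for the first column, $u^j_2(\boldsymbol v)$ for the second) is not outgoing at $\boldsymbol v$. $\mathcal F_{out}(\boldsymbol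 v)$ is the $2|J_{\boldsymbol v}|\times k_{\boldsymbol v}$ matrix obtained from $\widetilde{\mathcal F}_{out}(\boldsymbol v)$ by deleting its $2|J_{\boldsymbol v}|-k_{\boldsymbol v}$ zero columns, and $\mathcal F_{in}(\boldsymbol v)$ is the $2|J_{\boldsymbol v}|\times(2|J_{\boldsymbol v}|-k_{\boldsymbol v})$ matrix obtained in the same way from $\mathcal F(\boldsymbol v)-\widetilde{\mathcal F}_{out}(\boldsymbol v)$. Correspondingly, $\boldsymbol u_{out}(\boldsymbol v)\in\mathbb R^{k_{\boldsymbol v}}$ is the subvector of $\boldsymbol u(\boldsymbol v)$ consisting of the outgoing entries and $\boldsymbol u_{in}(\boldsymbol v)\in\mathbb R^{2|J_{\boldsymbol v}|-k_{\boldsymbol v}}$ the subvector of the incoming entries (order preserved). If $2|J_{\boldsymbol v}|-k_{\boldsymbol v}=0$, the terms involving $\boldsymbol u_{in}(\boldsymbol v)$ are absent (zero). *)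

(* Defs.v *)
From mathcomp Require Import all_boot all_order all_algebra.
From mathcomp Require Import all_classical all_reals.
From mathcomp Require Import ring.
Set Implicit Arguments.
Unset Strict Implicit.
Unset Printing Implicit Defensive.
Import Order.TTheory GRing.Theory Num.Theory.
Local Open Scope classical_set_scope.
Local Open Scope ring_scope.

(* Edges are closed: [edge j] contains its two endpoints, which are the only   *)
(* vertices on it.  As [coord j] is injective on [edge j], there are no loops; *)
(* with [edge_simple] (no multiple edges) the graph is simple.  The length     *)
(* metric is the one induced by the coordinates, so it is not a separate       *)
(* field; connectedness amounts to connectedness of the vertices by edges.     *)
Record metric_graph (R : realType) := MetricGraph {
  gpoint : Type;
  vertex : set gpoint;
  nedges : nat;
  edge : 'I_nedges -> set gpoint;
  coord : 'I_nedges -> gpoint -> R;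
  vertex_finite : finite_set vertex;
  coord_bij : forall j, set_bij (edge j) `[0, 1] (coord j);
  edge_endpoints : forall j x, edge j x ->
    (vertex x <-> coord j x = 0 \/ coord j x = 1);
  graph_cover : forall x, vertex x \/ exists j, edge j x;
  edge_meet : forall i j x, i != j -> edge i x -> edge j x -> vertex x;
  edge_simple : forall i j x y, i != j ->
    edge i x -> edge j x -> edge i y -> edge j y -> x = y;
  graph_connected : forall x y, vertex x -> vertex y ->
    exists s : seq gpoint,
      path (fun a b => [&& a \in vertex, b \in vertex &
                        [exists j, (a \in edge j) && (b \in edge j)]]) x s
      /\ last x s = y
}.

(* The data are functions on all of R, constrained on [0, 1] only. *)
Record hyperbolic_system (R : realType) (G : metric_graph R) :=
  HyperbolicSystem {
  coefM : 'I_(nedges G) -> R -> 'M[R]_2;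
  lamM : 'I_(nedges G) -> R -> R;
  lamP : 'I_(nedges G) -> R -> R;
  eigM : 'I_(nedges G) -> R -> 'cV[R]_2;
  eigP : 'I_(nedges G) -> R -> 'cV[R]_2;
  alpha : 'I_(nedges G) -> nat;
  lamM_lt_lamP : forall j x, 0 <= x <= 1 -> lamM j x < lamP j x;
  lamM_neq0 : forall j x, 0 <= x <= 1 -> lamM j x != 0;
  lamP_neq0 : forall j x, 0 <= x <= 1 -> lamP j x != 0;
  eigM_neq0 : forall j x, 0 <= x <= 1 -> eigM j x != 0;
  eigP_neq0 : forall j x, 0 <= x <= 1 -> eigP j x != 0;
  eigM_eq : forall j x, 0 <= x <= 1 ->
    coefM j x *m eigM j x = lamM j x *: eigM j x;
  eigP_eq : forall j x, 0 <= x <= 1 ->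
    coefM j x *m eigP j x = lamP j x *: eigP j x;
  alphaE : forall j x, 0 <= x <= 1 ->
    alpha j = ((0 < lamM j x)%R + (0 < lamP j x)%R)%N
}.

Section Vertex.
Variables (R : realType) (G : metric_graph R) (S : hyperbolic_system G).
Variable v : gpoint G.

Definition incident : {set 'I_(nedges G)} := [set j | v \in edge j]%SET.

(* The size 2|J_v| (see [vdimE]), in the form given by [\mxdiag].              *)
Definition vdim : nat := (\sum_(i < #|incident|) 2)%N.

Lemma vdimE : vdim = (2 * #|incident|)%N.
Proof. by rewrite /vdim sum_nat_const card_ord mulnC. Qed.

Definition block_edge (i : 'I_#|incident|) : 'I_(nedges G) := enum_val i.

Definition Fedge (j : 'I_(nedges G)) (x : R) : 'M[R]_2 :=
  \matrix_(i < 2, c < 2) (if c == 0 then eigP S j x i 0 else eigM S j x i 0).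

Definition Fmx : 'M[R]_vdim :=
  \mxdiag_(i < #|incident|) Fedge (block_edge i) (coord (block_edge i) v).

(* [c = 0] stands for u_1 (associated with lamP), [c = 1] for u_2 (with lamM). *)
Definition outgoing (j : 'I_(nedges G)) (c : 'I_2) : bool :=
  if coord j v == 0 then
    match alpha S j with 2 => true | 1 => c == 0 | _ => false end
  else
    match alpha S j with 2 => false | 1 => c == 1 | _ => true end.

(* The coordinate s of u(v) is component [comp_of s] of block [block_of s]. *)
Definition block_of (s : 'I_vdim) : 'I_#|incident| :=
  @tagnat.sig1 #|incident| (fun=> 2%N) s.
Definition comp_of (s : 'I_vdim) : 'I_2 :=
  @tagnat.sig2 #|incident| (fun=> 2%N) s.

Definition out_set : {set 'I_vdim} :=
  [set s : 'I_vdim | outgoing (block_edge (block_of s)) (comp_of s)]%SET.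

(* The closed formula for k_v is [kdimE]; the size of u_in is [indimE]. *)
Definition kdim : nat := #|out_set|.
Definition indim : nat := #|~: out_set|.

Definition is_sink : Prop := forall j, j \in incident ->
  (alpha S j = 2%N /\ coord j v = 1) \/ (alpha S j = 0%N /\ coord j v = 0).

Definition Fedge_out (j : 'I_(nedges G)) : 'M[R]_2 :=
  \matrix_(i < 2, c < 2) (if outgoing j c then Fedge j (coord j v) i c else 0).

Definition Ftilde_out : 'M[R]_vdim :=
  \mxdiag_(i < #|incident|) Fedge_out (block_edge i).

(* [enum_val] enumerates a set of ordinals increasingly, so order is kept. *)
Definition out_idx (s : 'I_kdim) : 'I_vdim := enum_val s.
Definition in_idx (s : 'I_indim) : 'I_vdim := enum_val s.

Definition F_out : 'M[R]_(vdim, kdim) := colsub out_idx Ftilde_out.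
Definition F_in : 'M[R]_(vdim, indim) := colsub in_idx (Fmx - Ftilde_out).

Definition u_out (u : 'cV[R]_vdim) : 'cV[R]_kdim := rowsub out_idx u.
Definition u_in (u : 'cV[R]_vdim) : 'cV[R]_indim := rowsub in_idx u.

Definition boundary_system (Phi : 'M[R]_(kdim, vdim)) (u : 'cV[R]_vdim) : Prop :=
  Phi *m Fmx *m u = 0.

Definition split_system (Phi : 'M[R]_(kdim, vdim))
    (uo : 'cV[R]_kdim) (ui : 'cV[R]_indim) : Prop :=
  Phi *m F_out *m uo + Phi *m F_in *m ui = 0.

Definition determines_outgoing (Phi : 'M[R]_(kdim, vdim)) : Prop :=
  forall ui : 'cV[R]_indim, exists! uo : 'cV[R]_kdim,
    exists u : 'cV[R]_vdim,
      [/\ u_out u = uo, u_in u = ui & boundary_system Phi u].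

Lemma indimE : indim = (2 * #|incident| - kdim)%N.
Proof. by rewrite /indim /kdim -vdimE cardsCs finset.setCK card_ord. Qed.

Lemma alpha_le2 j : (alpha S j <= 2)%N.
Proof.
rewrite (@alphaE _ _ S j 0) ?lexx ?ler01 //.
by case: (0 < _); case: (0 < _).
Qed.

Lemma incident_coord01 j : vertex v -> j \in incident ->
  coord j v = 0 \/ coord j v = 1.
Proof.
by move=> hv; rewrite inE => /set_mem ej; apply/(edge_endpoints ej).
Qed.

Lemma coord01 (j : 'I_(nedges G)) (x : gpoint G) : edge j x -> 0 <= coord j x <= 1.
Proof. by move=> ejx; have [+ _ _] := coord_bij j => /(_ x ejx); rewrite /= in_itv. Qed.

Lemma kdim_sum : kdim = (\sum_(j in incident) \sum_(c < 2) outgoing j c)%N.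
Proof.
rewrite big_enum_val /= /kdim -sum1_card big_mkcond /=.
rewrite (reindex _ (@tagnat.rank_bij_on #|incident| (fun=> 2%N))) /=.
rewrite sig_big_dep /=; apply: eq_big => [[? ?] //|p _].
rewrite inE /block_of /comp_of /tagnat.sig1 /tagnat.sig2 tagnat.rankK.
by case: outgoing.
Qed.

Lemma kdimE : vertex v ->
  kdim%:R = \sum_(j in incident)
    (2 * (1 - (alpha S j)%:R) * coord j v + (alpha S j)%:R) :> R.
Proof.
move=> hv; rewrite kdim_sum natr_sum; apply: eq_bigr => j jv.
rewrite !big_ord_recl big_ord0 /outgoing /= addn0.
have := alpha_le2 j; case: (alpha S j) => [|[|[|//]]] _;
  have [->|->] := incident_coord01 hv jv; rewrite ?eqxx ?oner_eq0 /=; ring.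
Qed.

Lemma is_sinkE : vertex v -> is_sink <-> kdim = 0%N.
Proof.
move=> hv; rewrite kdim_sum; split.
  move=> sk; rewrite big1 // => j /sk; rewrite !big_ord_recl big_ord0 /outgoing.
  by case=> -[-> ->]; rewrite ?eqxx ?oner_eq0.
move/eqP; rewrite sum_nat_eq0 => /forall_inP h j jv; move: (h j jv).
rewrite !big_ord_recl big_ord0 /outgoing.
have := alpha_le2 j; case: (alpha S j) => [|[|[|//]]] _;
  by have [->|->] := incident_coord01 hv jv; rewrite ?eqxx ?oner_eq0 //; auto.
Qed.

Lemma FmxE r s : Fmx r s =
  if block_of r == block_of s then
    Fedge (block_edge (block_of s)) (coord (block_edge (block_of s)) v)
      (comp_of r) (comp_of s)
  else 0.
Proof.
rewrite /Fmx /mxdiag mxE -/(block_of r) -/(block_of s) -/(comp_of r) -/(comp_of s).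
by case: eqP => [->|_]; rewrite ?conform_mx_id ?mxE.
Qed.

Lemma Ftilde_outE r s : Ftilde_out r s = if s \in out_set then Fmx r s else 0.
Proof.
rewrite FmxE inE /Ftilde_out /mxdiag mxE.
rewrite -/(block_of r) -/(block_of s) -/(comp_of r) -/(comp_of s).
case: eqP => [->|_]; last by rewrite mxE if_same.
by rewrite conform_mx_id mxE.
Qed.

Lemma Fmx_col_neq0 s : col s Fmx != 0.
Proof.
have ej : edge (block_edge (block_of s)) v.
  by have := enum_valP (block_of s); rewrite inE => /set_mem.
apply/eqP => /matrixP c0.
have Fe0 i : Fedge (block_edge (block_of s)) (coord (block_edge (block_of s)) v)
    i (comp_of s) = 0.
  have := c0 (tagnat.Rank (p_ := fun=> 2%N) (block_of s) i) 0.
  rewrite [LHS]mxE [RHS]mxE FmxE /block_of /comp_of tagnat.Rank1K eqxx.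
  by rewrite tagnat.Rank2K /= cast_ord_id !mxE.
have /negP eP := eigP_neq0 S (block_edge (block_of s)) (coord01 ej).
have /negP eM := eigM_neq0 S (block_edge (block_of s)) (coord01 ej).
case: (eqVneq (comp_of s) 0) => cs; [apply: eP|apply: eM];
  apply/eqP/matrixP => i k; rewrite mxE ord1; move: (Fe0 i); rewrite mxE.
  by rewrite cs eqxx.
by rewrite (negPf cs).
Qed.

(* [F_out] and [F_in] delete exactly the zero columns of [Ftilde_out] and      *)
(* [Fmx - Ftilde_out].                                                         *)
Lemma out_setE s : (s \in out_set) = (col s Ftilde_out != 0).
Proof.
have cE i k : col s Ftilde_out i k = if s \in out_set then Fmx i s else 0.
  by rewrite mxE Ftilde_outE.
case: (boolP (s \in out_set)) cE => hs cE; apply/esym.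
  suff -> : col s Ftilde_out = col s Fmx by exact: Fmx_col_neq0.
  by apply/matrixP => i k; rewrite cE [RHS]mxE.
by apply/negbTE/negPn/eqP/matrixP => i k; rewrite cE [RHS]mxE.
Qed.

Lemma in_setE s : (s \in ~: out_set) = (col s (Fmx - Ftilde_out) != 0).
Proof.
have cE i k : col s (Fmx - Ftilde_out) i k =
    Fmx i s - if s \in out_set then Fmx i s else 0.
  by rewrite -Ftilde_outE [LHS]mxE [LHS]mxE; congr (_ + _); rewrite mxE.
rewrite finset.in_setC.
case: (boolP (s \in out_set)) cE => hs cE; apply/esym.
  by apply/negbTE/negPn/eqP/matrixP => i k; rewrite cE subrr [RHS]mxE.
suff -> : col s (Fmx - Ftilde_out) = col s Fmx by exact: Fmx_col_neq0.
by apply/matrixP => i k; rewrite cE subr0 [RHS]mxE.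
Qed.

End Vertex.

(* Main.v *)
Require Import Defs.
From mathcomp Require Import all_boot all_order all_algebra.
From mathcomp Require Import all_classical all_reals.
Import Order.TTheory GRing.Theory Num.Theory.
Local Open Scope ring_scope.

(** Sorting the coordinates of [u] into outgoing and incoming ones turns [Fmx *m u] into the sum of
    an [F_out] and an [F_in] term ([mulmx_set_split]), which gives the equivalence of the two
    systems. Any pair [(uo, ui)] comes from some [u] ([rowsub_set_glue]), so determining the
    outgoing values means unique solvability in [uo] of a square linear system with matrix
    [Phi *m F_out S v]. If this matrix is invertible, the solution is explicit. Conversely,
    uniqueness for [ui = 0] makes its kernel trivial, hence the matrix invertible
    ([unitmx_ker0]). *)

Lemma mulmx_set_split (R : pzRingType) (m n p : nat) (A : {set 'I_n})
    (M : 'M[R]_(m, n)) (N : 'M[R]_(n, p)) :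
  M *m N = colsub (fun k : 'I_#|A| => enum_val k) M
             *m rowsub (fun k : 'I_#|A| => enum_val k) N
         + colsub (fun k : 'I_#|~: A| => enum_val k) M
             *m rowsub (fun k : 'I_#|~: A| => enum_val k) N.
Proof.
apply/matrixP => i j; rewrite !mxE (bigID (mem A)) /=; congr (_ + _).
  by rewrite big_enum_val; apply: eq_bigr => k _; rewrite !mxE.
rewrite (eq_bigl (mem (~: A))) => [|s]; last by rewrite /= finset.in_setC.
by rewrite big_enum_val; apply: eq_bigr => k _; rewrite !mxE.
Qed.

Lemma rowsub_set_glue (R : nmodType) (n p : nat) (A : {set 'I_n})
    (a : 'M[R]_(#|A|, p)) (b : 'M[R]_(#|~: A|, p)) :
  exists2 N : 'M[R]_(n, p),
    rowsub (fun k : 'I_#|A| => enum_val k) N = a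
  & rowsub (fun k : 'I_#|~: A| => enum_val k) N = b.
Proof.
(* Since [enum_val] is injective and the two index sets are complementary, at each [s] one sum has
   exactly one term and the other is empty. This avoids inverting [enum_val] across dependent
   types. *)
exists (\matrix_(s, j) (\sum_(k | enum_val k == s) a k j
                        + \sum_(k | enum_val k == s) b k j));
  apply/matrixP => i j; rewrite !mxE.
  rewrite (big_pred1 i) => [|k]; last by rewrite /= (inj_eq enum_val_inj).
  rewrite big_pred0 ?addr0 // => k; apply/negbTE/eqP => ki.
  by have := enum_valP k; rewrite ki finset.in_setC enum_valP.
rewrite addrC (big_pred1 i) => [|k]; last by rewrite /= (inj_eq enum_val_inj).
rewrite big_pred0 ?addr0 // => k; apply/negbTE/eqP => ki.
by have := enum_valP i; rewrite -ki finset.in_setC enum_valP.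
Qed.

Lemma unitmx_ker0 (F : fieldType) (n : nat) (A : 'M[F]_n) :
  (forall x : 'cV[F]_n, A *m x = 0 -> x = 0) -> A \in unitmx.
Proof.
(* Row freeness concerns left kernels, hence the passage to the transpose. *)
move=> kerA; rewrite -unitmx_tr -row_free_unit; apply/inj_row_free => y yA.
by apply: trmx_inj; rewrite trmx0; apply: kerA; rewrite -[A]trmxK -trmx_mul yA trmx0.
Qed.

Section Vertex.
Variables (R : realType) (G : metric_graph R) (S : hyperbolic_system G).
Variable v : gpoint G.

(** The zeroed columns of [Ftilde_out] are exactly those that [out_idx] skips. *)
Lemma F_outE : F_out S v = colsub (@out_idx R G S v) (Fmx S v).
Proof. by apply/matrixP => r k; rewrite mxE Ftilde_outE enum_valP [RHS]mxE. Qed.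

Lemma F_inE : F_in S v = colsub (@in_idx R G S v) (Fmx S v).
Proof.
apply/matrixP => r k; rewrite [RHS]mxE -[RHS]subr0 [LHS]mxE [LHS]mxE.
congr (_ + _); rewrite mxE Ftilde_outE.
by have /[!finset.in_setC] /negbTE -> := enum_valP k.
Qed.

Lemma Fmx_mul_split (u : 'cV[R]_(vdim v)) :
  Fmx S v *m u = F_out S v *m u_out S u + F_in S v *m u_in S u.
Proof. by rewrite F_outE F_inE; exact: mulmx_set_split. Qed.

Variable Phi : 'M[R]_(kdim S v, vdim v).

Lemma boundary_systemE (u : 'cV[R]_(vdim v)) :
  boundary_system Phi u <-> split_system Phi (u_out S u) (u_in S u).
Proof.
by rewrite /boundary_system /split_system -!mulmxA -mulmxDr -Fmx_mul_split.
Qed.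

(** Eliminates the full vector [u] from [determines_outgoing], leaving a linear system in [uo] with
    [ui] as a free parameter. *)
Lemma boundary_system_glue uo ui :
  (exists u, [/\ u_out S u = uo, u_in S u = ui & boundary_system Phi u]) <->
  split_system Phi uo ui.
Proof.
split=> [[u [<- <-]]|spl]; first by move/boundary_systemE.
have [u uuo uui] := @rowsub_set_glue _ _ _ (out_set S v) uo ui.
exists u; split=> //; apply/boundary_systemE.
by rewrite (_ : u_out S u = uo) // (_ : u_in S u = ui).
Qed.

Lemma split_systemE uo ui : Phi *m F_out S v \in unitmx ->
  split_system Phi uo ui <->
  uo = - (invmx (Phi *m F_out S v) *m Phi *m F_in S v *m ui).
Proof.
move=> uA; rewrite /split_system; split=> [/eqP|->].
  rewrite addr_eq0 => /eqP e.
  by rewrite -(mulKmx uA uo) e mulmxN !mulmxA.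
by rewrite mulmxN !mulmxA mulmxV // mul1mx addNr.
Qed.

Lemma determines_outgoing_unit :
  determines_outgoing Phi <-> Phi *m F_out S v \in unitmx.
Proof.
split=> [det|uA ui]; last first.
  exists (- (invmx (Phi *m F_out S v) *m Phi *m F_in S v *m ui)); split.
    by apply/boundary_system_glue/split_systemE.
  by move=> uo /boundary_system_glue/(split_systemE _ _ uA).
(* With zero incoming data, both [x] and [0] solve the split system, so both equal the unique
   solution [w]. *)
apply: unitmx_ker0 => x Ax0; have [w [_ uniq_w]] := det 0.
rewrite -[LHS]uniq_w ?(uniq_w 0) //; apply/boundary_system_glue.
  by rewrite /split_system !mulmx0 addr0.
by rewrite /split_system Ax0 mulmx0 addr0.
Qed.

End Vertex.

Theorem proposition3p8 (R : realType) (G : metric_graph R)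
    (S : hyperbolic_system G) (v : gpoint G) (hv : vertex v)
    (hns : ~ is_sink S v) (Phi : 'M[R]_(kdim S v, vdim v)) :
  [/\ forall u : 'cV[R]_(vdim v),
        boundary_system Phi u <-> split_system Phi (u_out S u) (u_in S u),
      determines_outgoing Phi <-> Phi *m F_out S v \in unitmx
    & Phi *m F_out S v \in unitmx ->
      forall u : 'cV[R]_(vdim v), boundary_system Phi u ->
        u_out S u = - (invmx (Phi *m F_out S v) *m Phi *m F_in S v *m u_in S u)].
Proof.
split; [exact: boundary_systemE | exact: determines_outgoing_unit |].
by move=> uA u /boundary_systemE/(split_systemE _ _ _ _ _ _ _ uA).
Qed.
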